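(* Let $X\subseteq 2^\omega$ be Borel. Then the following are equivalent: (1) $X^\omega$ is countable dense homogeneous (CDH); (2) $X$ is $G_\delta$ in $2^\omega$; (3) $|X^\omega|=1$, or $X^\omega$ is homeomorphic to $2^\omega$, or $X^\omega$ is homeomorphic to $\omega^\omega$.
   Context: A separable topological space $Y$ is countable dense homogeneous (CDH) if for any two countable dense subsets $D, D' \subseteq Y$ there is a homeomorphism $h : Y \to Y$ such that $h[D]=D'$. $X$ carries the subspace topology from the Cantor space $2^\omega$, $X^\omega$ is the countably infinite power with the product topology, and $\omega^\omega$ is the Baire space.
   Formalization: X is assumed nonempty: for X empty, the power X^ω is empty, so (1) and (2) hold, but (3) fails because |X^ω| = 0 and neither 2^ω nor ω^ω is empty. *)

(* Defs.v *)
From HB Require Import structures.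
From mathcomp Require Import all_boot all_order all_algebra.
From mathcomp Require Import all_classical all_reals all_analysis.

Set Implicit Arguments.
Unset Strict Implicit.
Unset Printing Implicit Defensive.

Local Open Scope classical_set_scope.

Definition homeomorphism (S T : topologicalType) (f : S -> T) : Prop :=
  continuous f /\
  exists g : T -> S, [/\ continuous g, cancel f g & cancel g f].

Definition homeomorphic (S T : topologicalType) : Prop :=
  exists f : S -> T, homeomorphism f.

Definition separable_space (T : topologicalType) : Prop :=
  exists2 D : set T, countable D & dense D.

(* [countable] includes finite sets. *)
Definition countable_dense_homogeneous (T : topologicalType) : Prop :=
  separable_space T /\
  forall D D' : set T,
    countable D -> dense D -> countable D' -> dense D' ->
    exists2 h : T -> T, homeomorphism h & h @` D = D'.

Definition borel_set (T : topologicalType) (A : set T) : Prop :=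
  <<s @open T >> A.

(* [nat] carries the discrete topology. *)
Definition baire_space : Type := prod_topology (fun _ : nat => nat).

HB.instance Definition _ := Topological.on baire_space.

(* The set [X] is coerced to the type [set_type X], which carries the initial
   topology for the inclusion; the library's [subspace X] would instead
   retopologize the whole ambient type. *)
Definition omega_power (T : topologicalType) (X : set T) : Type :=
  prod_topology (fun _ : nat => X : Type).

HB.instance Definition _ (T : topologicalType) (X : set T) :=
  Topological.on (omega_power X).

(* Main.v *)
Require Import Defs.
From mathcomp Require Import all_boot all_order all_algebra.
From mathcomp Require Import all_classical all_reals all_analysis borel_hierarchy.

(** Every space here is described by digits, i.e. as a subspace of the power
    [A^omega] of a discrete set [A], and an open set by the prefixes that force
    membership.  Write [K] for the closure of [X].

    G-delta implies the trichotomy.  If [X] is closed, its power is a closed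
    subspace of a power of [bool], and without isolated points when [X] has two
    points.  If [X] is a G-delta set but not closed, adding to the digits of a
    point the lengths of the prefixes that witness its membership in the open
    sets makes its power a closed subspace of a sequence space, and some of the
    new digits are unbounded.  Cutting successively into nonempty clopen pieces,
    two at a time or infinitely many at a time, identifies the power with the
    Cantor or the Baire space ([address_system], [Gdelta_trichotomy]).

    The Cantor and Baire spaces are CDH.  In the same construction each piece is
    marked by its first point in a given countable dense set [D], and the mark
    is always put in the subpiece of index zero.  Then [D] is identified with
    the eventually zero sequences, whatever [D] was ([cantor_cdh],
    [baire_cdh]).

    CDH implies G-delta, for a Borel [X] with at least two points.  The power of
    [X] is not meager in itself, since otherwise one countable dense set would
    meet every member of a meager cover in a finite set, while another one is
    dense in a copy of the Cantor space ([cdh_nonmeager]).  As Borel sets have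
    the Baire property, [X] then contains a dense G-delta subset [H] of [K]
    ([nonmeager_power_comeager]).  So some countable dense set of the power is
    inside the completely metrizable power of [H]; by homogeneity the constant
    sequences with value in any countable subset [B] of [X] are inside a
    homeomorphic image of that power, whence [B] is enclosed in a G-delta set of
    the Cantor space contained in [X] ([bigcap_enclosing_sub]).  Finally, if the
    complement of [X] is analytic, as it is for a Borel [X], and every countable
    subset of [X] can be so enclosed, then [X] is a G-delta set: this is the
    Baire category argument behind Hurewicz's theorem
    ([countably_enclosed_Gdelta]). *)

Set Implicit Arguments.
Unset Strict Implicit.
Unset Printing Implicit Defensive.

Local Open Scope classical_set_scope.
Local Open Scope card_scope.

(** * Spaces presented by sequences of digits *)

Lemma countable_image S T (f : S -> T) (D : set S) :
  countable D -> countable (f @` D).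
Proof. exact/sub_countable/card_image_le. Qed.

Lemma countable_setU T (S1 S2 : set T) :
  countable S1 -> countable S2 -> countable (S1 `|` S2).
Proof.
move=> c1 c2; rewrite -bigcup2E; apply: bigcup_countable.
  exact: countableP.
by move=> [|[|n]] _.
Qed.

Definition agree (A : Type) (n : nat) (x y : nat -> A) : Prop :=
  forall k, (k < n)%N -> x k = y k.

Lemma agree_sym A n (x y : nat -> A) : agree n x y -> agree n y x.
Proof. by move=> xy k kn; rewrite xy. Qed.

Lemma agree_trans A n (x y z : nat -> A) :
  agree n x y -> agree n y z -> agree n x z.
Proof. by move=> xy yz k kn; rewrite xy // yz. Qed.

Lemma agree_le A m n (x y : nat -> A) : (m <= n)%N -> agree n x y -> agree m x y.
Proof. by move=> mn xy k km; apply: xy; exact: leq_trans mn. Qed.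

Lemma agree_mkseq A n (x y : nat -> A) : agree n x y <-> mkseq x n = mkseq y n.
Proof.
split=> [xy|xy k kn].
  by apply/eq_in_map => k; rewrite mem_iota add0n => /xy.
by rewrite -(nth_mkseq (x k) x kn) xy nth_mkseq.
Qed.

(** A zero-dimensional topology presented by digits: [d] embeds [T] in the
    power [A^omega] of the discrete space [A].  If moreover the range of [d] is
    [prefix_closed], i.e. closed in [A^omega], then [T] is completely
    metrizable; this pair of conditions replaces metrics throughout. *)
Definition digit_base (T : topologicalType) (A : Type) (d : T -> nat -> A) :=
  injective d /\
  forall t U, nbhs t U <-> exists n, forall u, agree n (d u) (d t) -> U u.

Definition prefix_closed (A : Type) (F : set (nat -> A)) : Prop :=
  forall x, (forall n, exists2 y, F y & agree n y x) -> F x.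

Section DigitBase.
Context (T : topologicalType) (A : Type) (d : T -> nat -> A).
Hypothesis dT : digit_base d.

Lemma nbhs_agree t n : nbhs t [set u | agree n (d u) (d t)].
Proof. by apply/dT.2; exists n. Qed.

Lemma digit_open U :
  open U <-> forall t, U t -> exists n, forall u, agree n (d u) (d t) -> U u.
Proof.
rewrite openE; split=> [oU t /oU /dT.2 //|oU t Ut].
by apply/dT.2; exact: oU.
Qed.

Lemma digit_closed C :
  closed C <-> forall t, (forall n, exists2 u, C u & agree n (d u) (d t)) -> C t.
Proof.
rewrite -openC digit_open; split=> [oC t tC|cC t nCt].
  by apply: contrapT => /oC[n nC]; have [u Cu /nC] := tC n.
apply: contrapT => /forallNP nC; apply: nCt; apply: cC => n.
by have /existsNP[u /not_implyP[ut /contrapT Cu]] := nC n; exists u.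
Qed.

Lemma digit_open_ball t n : open [set u | agree n (d u) (d t)].
Proof.
by apply/digit_open => u ut; exists n => v vu; exact: agree_trans ut.
Qed.

Lemma digit_closure C t :
  closure C t <-> forall n, exists2 u, C u & agree n (d u) (d t).
Proof.
split=> [Ct n|tC U /dT.2[n nU]].
  by have [u [Cu ut]] := Ct _ (nbhs_agree t n); exists u.
by have [u Cu /nU Uu] := tC n; exists u.
Qed.

Lemma digit_dense D :
  dense D <-> forall t n, exists2 u, D u & agree n (d u) (d t).
Proof.
split=> [dD t n|dD U [t Ut] /digit_open /(_ _ Ut)[n nU]].
  have [|u [ut Du]] := dD _ _ (digit_open_ball t n); first by exists t.
  by exists u.
by have [u Du /nU Uu] := dD t n; exists u.
Qed.

End DigitBase.

Lemma digit_continuous (S T : topologicalType) A B (d : S -> nat -> A)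
    (e : T -> nat -> B) (f : S -> T) : digit_base d -> digit_base e ->
  continuous f <-> forall s n, exists m, forall u, agree m (d u) (d s) ->
    agree n (e (f u)) (e (f s)).
Proof.
move=> dS eT; split=> [cf s n|cf s U /eT.2[n nU]].
  have : nbhs s (f @^-1` [set t | agree n (e t) (e (f s))]).
    by apply: cf; exact: nbhs_agree.
  by move=> /dS.2.
by apply/dS.2; have [m fm] := cf s n; exists m => u /fm /nU.
Qed.

Lemma cvg_prod_topology (K : nat -> topologicalType)
    (F : set_system (prod_topology K)) (t : prod_topology K) : Filter F ->
  (forall i U, nbhs (t i) U -> F [set u | U (u i)]) -> nbhs t `<=` F.
Proof.
move=> FF Ft; apply/cvg_sup => i U [_ [[V oV <-] Vt VU]].
by apply: (filterS VU); apply: Ft; exact: open_nbhs_nbhs.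
Qed.

Lemma prod_digit_base (K : nat -> topologicalType) A
    (D : prod_topology K -> nat -> A) :
  injective D ->
  (forall i (t : prod_topology K) U, nbhs (t i) U ->
     exists n, forall u, agree n (D u) (D t) -> U (u i)) ->
  (forall n (t : prod_topology K), exists i (U : set (K i)), nbhs (t i) U /\
     forall u : prod_topology K, U (u i) -> D u n = D t n) ->
  digit_base D.
Proof.
move=> Dinj Dbase Dcont; split=> // t U; split=> [|[n nU]].
  pose F := filter_from [set: nat] (fun n => [set u | agree n (D u) (D t)]).
  have FF : Filter F.
    apply: filter_from_filter => [|i j _ _]; first by exists 0%N.
    exists (maxn i j) => // u ut.
    by split; apply: agree_le ut; rewrite ?leq_maxl ?leq_maxr.
  move/(@cvg_prod_topology _ F t FF) => -[|n _ nU]; last by exists n => u /nU.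
  by move=> i V /Dbase[n nV]; exists n.
apply: (filterS nU); elim: n {nU} => [|n IH]; first exact: (filterS _ filterT).
have [i [V [Vt VD]]] := Dcont n t.
have /(_ t V Vt) Vn := @proj_continuous nat K i.
apply: filterS (filterI IH Vn) => u [un Vu] k; rewrite ltnS leq_eqVlt.
by case/orP => [/eqP ->|/un//]; exact: VD.
Qed.

Lemma discrete_prod_digit_base (K : discreteTopologicalType) :
  digit_base (id : prod_topology (fun _ : nat => K) -> nat -> K).
Proof.
apply: prod_digit_base => // [i t U /nbhs_singleton Ut|n t].
  by exists i.+1 => u /(_ i (ltnSn i)) ->.
by exists n, [set t n]; split; [exact: discrete_set1|].
Qed.

Lemma cantor_digit_base : digit_base (id : cantor_space -> nat -> bool).
Proof. exact: discrete_prod_digit_base. Qed.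

Lemma baire_digit_base : digit_base (id : baire_space -> nat -> nat).
Proof. exact: discrete_prod_digit_base. Qed.

(** The decoding [unpair] is onto but not injective: some [n] are not codes and
    decode to [(0, 0)].  A power then merely repeats a digit, which harms
    neither injectivity nor the topology. *)
Definition unpair (n : nat) : nat * nat := odflt (0, 0)%N (unpickle n).
Definition pair_code (i j : nat) : nat := pickle (i, j).

Lemma pair_codeK i j : unpair (pair_code i j) = (i, j).
Proof. by rewrite /unpair pickleK. Qed.

(** The digits of all the coordinates of [t], interleaved. *)
Definition power_digits (Z A : Type) (d : Z -> nat -> A) (t : nat -> Z)
    (n : nat) : A :=
  d (t (unpair n).1) (unpair n).2.

Lemma power_digitsE (Z A : Type) (d : Z -> nat -> A) (t : nat -> Z) i j :
  power_digits d t (pair_code i j) = d (t i) j.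
Proof. by rewrite /power_digits pair_codeK. Qed.

Lemma ubound_fun (f : nat -> nat) n : exists m, forall k, (k < n)%N -> (f k < m)%N.
Proof.
exists (\max_(k < n) f k).+1 => k kn.
by rewrite ltnS (leq_bigmax (Ordinal kn)).
Qed.

Lemma power_digits_agree (Z A : Type) (d : Z -> nat -> A) i j :
  exists n, forall t u : nat -> Z,
    agree n (power_digits d t) (power_digits d u) -> agree j (d (t i)) (d (u i)).
Proof.
have [n ltn] := ubound_fun (pair_code i) j.
by exists n => t u tu k kj; have := tu _ (ltn k kj); rewrite !power_digitsE.
Qed.

Lemma agree_power_digits (Z A : Type) (d : Z -> nat -> A) n :
  exists m, forall t u : nat -> Z,
    (forall i, (i < m)%N -> agree m (d (t i)) (d (u i))) ->
    agree n (power_digits d t) (power_digits d u).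
Proof.
have [m1 lt1] := ubound_fun (fun k => (unpair k).1) n.
have [m2 lt2] := ubound_fun (fun k => (unpair k).2) n.
exists (maxn m1 m2) => t u tu k kn; apply: tu.
  by apply: leq_trans (leq_maxl _ _); exact: lt1.
by apply: leq_trans (leq_maxr _ _); exact: lt2.
Qed.

Lemma power_digit_base (Z : topologicalType) A (d : Z -> nat -> A) :
  digit_base d ->
  digit_base (power_digits d : prod_topology (fun _ : nat => Z) -> nat -> A).
Proof.
move=> dZ; apply: prod_digit_base => [t u tu|i t U /dZ.2[j jU]|n t].
- apply/funext => i; apply: dZ.1; apply/funext => j.
  by have := congr1 (@^~ (pair_code i j)) tu; rewrite /= !power_digitsE.
- have [n nj] := power_digits_agree d i j.
  by exists n => u /nj /jU.
- exists (unpair n).1, [set z | agree (unpair n).2.+1 (d z) (d (t (unpair n).1))].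
  split; first exact: nbhs_agree.
  by move=> u; apply.
Qed.

Lemma power_prefix_closed (Z A : Type) (d : Z -> nat -> A) :
  prefix_closed (range d) ->
  prefix_closed (range (power_digits d)).
Proof.
move=> cd x xlim.
have /choice[t tx] : forall i, exists z, d z = fun j => x (pair_code i j).
  move=> i; suff [z _ zx] : range d (fun j => x (pair_code i j)) by exists z.
  apply: cd => j; have [n nj] := ubound_fun (pair_code i) j.
  have [_ [t _ <-] tx] := xlim n; exists (d (t i)); first by exists (t i).
  by move=> k kj; rewrite -tx ?nj // power_digitsE.
exists t => //; apply/funext => n.
have [_ [u _ <-] ux] := xlim (maxn n (pair_code (unpair n).1 (unpair n).2)).+1.
rewrite /power_digits tx -!ux ?ltnS ?leq_maxl ?leq_maxr //.
by rewrite power_digitsE.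
Qed.

Section Subspace.
Context (X : set cantor_space).

Definition val_digits (x : X) : nat -> bool := val x.

Lemma val_digit_base : digit_base val_digits.
Proof.
split=> [x y /val_inj //|x U]; split=> [[_ [[V oV <-] Vx VU]]|[n nU]].
  have [n nV] := (digit_open cantor_digit_base V).1 oV _ Vx.
  by exists n => u /nV /VU.
apply: (filterS nU).
have cv : continuous (val : X -> cantor_space) by exact: initial_continuous.
exact: (cv x _ (nbhs_agree cantor_digit_base (val x) n)).
Qed.

End Subspace.

(** * Renaming digits so that a countable dense set becomes standard *)

Section Scheme.
Context (T : topologicalType) (A : Type) (d : T -> nat -> A).
Context (I : Type) (i0 : I) (e : nat -> T).

(** One partition step: [s] cuts the open set [C] into nonempty clopen pieces
    indexed by [I], in such a way that each piece decides the [n]-th digit and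
    that the distinguished point [p] lands in the piece of index [i0]. *)
Record splitting (n : nat) (C : set T) (p : T) (s : T -> I) : Prop := {
  split_cont : forall t, nbhs t [set u | s u = s t];
  split_pt : s p = i0;
  split_onto : forall i, exists2 t, C t & s t = i;
  split_digit : forall t u, C t -> C u -> s t = s u -> d t n = d u n }.

(** Each cell is marked by the point of [range e] of least index in it.  The
    marking is coherent: a subcell that contains the mark of a cell has the
    same mark. *)
Definition first_index (C : set T) : nat :=
  xget 0%N [set k | C (e k) /\ forall j, C (e j) -> (k <= j)%N].

Hypothesis dT : digit_base d.
Hypothesis dC : prefix_closed (range d).
Hypothesis De : dense (range e).

Lemma first_indexP C : open C -> C !=set0 ->
  C (e (first_index C)) /\ forall j, C (e j) -> (first_index C <= j)%N.
Proof.
move=> oC C0; have [t [Ct [k _ ekt]]] := De C0 oC.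
have ex : exists k, `[< C (e k) >] by exists k; apply/asboolP; rewrite ekt.
suff : [set k | C (e k) /\ forall j, C (e j) -> (k <= j)%N] !=set0.
  by move=> ex0; exact: (xgetPex 0%N ex0).
case: (ex_minnP ex) => m /asboolP Cm mmin; exists m; split=> // j Cj.
by apply: mmin; apply/asboolP.
Qed.

Variable s : nat -> set T -> T -> I.
Hypothesis sP : forall n C, clopen C -> C !=set0 ->
  splitting n C (e (first_index C)) (s n C).

Fixpoint cell (t : T) (n : nat) : set T :=
  if n is m.+1 then
    cell t m `&` [set u | s m (cell t m) u = s m (cell t m) t]
  else setT.

(** The new digits.  As every partition is indexed by the whole of [I], every
    sequence turns out to be an address; as cells decide the old digits, the
    addresses define the same topology. *)
Definition address (t : T) (n : nat) : I := s n (cell t n) t.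

Lemma clopen_piece n C i : clopen C -> C !=set0 ->
  clopen (C `&` [set u | s n C u = i]).
Proof.
move=> clC C0; apply: clopenI => //; split.
  rewrite openE => t <-; exact: (split_cont (sP n clC C0)).
rewrite -openC openE => t nt.
apply: filterS (split_cont (sP n clC C0) t) => u /= ut ui; apply: nt.
by rewrite /= -ut.
Qed.

Lemma cell_self t n : cell t n t.
Proof. by elim: n. Qed.

Lemma cell_clopen t n : clopen (cell t n).
Proof.
elim: n => [|n IH]; first exact: clopenT.
by apply: clopen_piece => //; exists t; exact: cell_self.
Qed.

Lemma cell_splitting t n :
  splitting n (cell t n) (e (first_index (cell t n))) (s n (cell t n)).
Proof. by apply: sP; [exact: cell_clopen|exists t; exact: cell_self]. Qed.

Lemma cell_le t m n : (m <= n)%N -> cell t n `<=` cell t m.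
Proof.
move=> /subnK <-; elim: (n - m)%N => // k IH u; rewrite addSn => -[+ _].
exact: IH.
Qed.

Lemma cell_agree_eq t u n :
  (agree n (address u) (address t) <-> cell t n u) /\
  (cell t n u -> cell u n = cell t n).
Proof.
elim: n => [//|n [IH1 IH2]]; split.
  split=> [ut|[tu /= sut] k].
    have tu : cell t n u by apply/IH1; exact: agree_le ut.
    by split=> //=; move: (ut n (ltnSn n)); rewrite /address IH2.
  rewrite ltnS leq_eqVlt => /orP[/eqP ->|]; last by move: k; exact/IH1.
  by rewrite /address IH2.
by move=> [tu /= sut]; rewrite (IH2 tu) sut.
Qed.

Lemma agree_cell t u n : agree n (address u) (address t) <-> cell t n u.
Proof. exact: (cell_agree_eq t u n).1. Qed.

Lemma cell_digit t u n : cell t n.+1 u -> d u n = d t n.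
Proof.
move=> [tu /= sut]; apply: (split_digit (cell_splitting t n)) => //.
exact: cell_self.
Qed.

Lemma address_agree t u n : agree n (address u) (address t) -> agree n (d u) (d t).
Proof.
move=> /agree_cell tu k kn; apply: cell_digit.
exact: cell_le tu.
Qed.

Lemma address_digit_base : digit_base address.
Proof.
split=> [t u tu|t U].
  apply: dT.1; apply/funext => n; apply: (@address_agree _ _ n.+1) => //.
  by rewrite tu.
split=> [/dT.2[n nU]|[n nU]]; first by exists n => u /address_agree/nU.
have : nbhs t (cell t n).
  apply: open_nbhs_nbhs; split; [exact: (cell_clopen t n).1|exact: cell_self].
by apply: filterS => u /agree_cell/nU.
Qed.

Fixpoint branch (x : nat -> I) (n : nat) : set T :=
  if n is m.+1 then branch x m `&` [set u | s m (branch x m) u = x m]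
  else setT.

Lemma branch_clopen x n : clopen (branch x n) /\ branch x n !=set0.
Proof.
have T0 : [set: T] !=set0 by exists (e 0%N).
elim: n => [|n [clB B0]]; first by split=> //; exact: clopenT.
split; first exact: clopen_piece.
by have [t Bt st] := split_onto (sP n clB B0) (x n); exists t.
Qed.

Lemma branch_le x m n : (m <= n)%N -> branch x n `<=` branch x m.
Proof.
move=> /subnK <-; elim: (n - m)%N => // k IH u; rewrite addSn => -[+ _].
exact: IH.
Qed.

(** The cells along a branch are nonempty clopen sets that decide all the old
    digits; these digits are realized by a point because the range of [d] is
    closed, and the point stays in every cell because cells are closed. *)
Lemma address_surjective x : exists t, address t = x.
Proof.
have /choice[u uB] : forall n, exists t, branch x n t.
  by move=> n; have [_ [t Bt]] := branch_clopen x n; exists t.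
have digB n v w : branch x n.+1 v -> branch x n.+1 w -> d v n = d w n.
  move=> [Bv /= sv] [Bw /= sw]; have [clB B0] := branch_clopen x n.
  by apply: (split_digit (sP n clB B0)) => //; rewrite sv sw.
(* the digit of index n is only decided by the cell of level n.+1 *)
pose y n := d (u n.+1) n.
have uy n : agree n (d (u n)) y.
  by move=> k kn; apply: digB => //; exact: branch_le (uB n).
have [t _ ty] : range d y.
  by apply: dC => n; exists (d (u n)).
have Bt n : branch x n t.
  have [[_ /(digit_closed dT)cB] _] := branch_clopen x n; apply: cB => m.
  exists (u (maxn m n)); first by apply: branch_le (uB _); rewrite leq_maxr.
  by rewrite ty; apply: agree_le (uy _); rewrite leq_maxl.
have cellB n : cell t n = branch x n.
  elim: n => // n IH /=; rewrite IH.
  by have [_ /= ->] := Bt n.+1.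
exists t; apply/funext => n; rewrite /address cellB.
by have [_ /= ->] := Bt n.+1.
Qed.

(** A point [e k] ends up in cells without any [e j], [j < k], other than itself;
    from then on it is the mark of its cell and its digits are [i0].  Conversely
    if the digits of [t] are eventually [i0] then its cells eventually all have
    the same mark, which must be [t]. *)
Lemma range_address :
  range e = [set t | exists N, forall n, (N <= n)%N -> address t n = i0].
Proof.
have cellf t n : cell t n (e (first_index (cell t n))) /\
    forall j, cell t n (e j) -> (first_index (cell t n) <= j)%N.
  by apply: first_indexP; [exact: (cell_clopen t n).1|exists t; exact: cell_self].
apply/seteqP; split=> [_ [k _ <-]|t [N tN]] /=.
  set t := e k.
  have sep j : exists n, cell t n (e j) -> e j = t.
    have [->|jt] := EM (e j = t).
      by exists 0%N.
    apply: contrapT => /forallNP nsep; apply: jt; apply: address_digit_base.1.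
    apply/funext => n; have /not_implyP[/agree_cell jt _] := nsep n.+1.
    exact: jt.
  have /choice[N Nsep] := sep.
  have [M ltM] := ubound_fun N k; exists M => n Mn.
  have [cf minf] := cellf t n.
  have : (first_index (cell t n) <= k)%N by apply: minf; exact: cell_self.
  have ft : e (first_index (cell t n)) = t.
    have := minf _ (cell_self t n); rewrite leq_eqVlt => /orP[/eqP -> //|fk].
    apply: Nsep; apply: cell_le cf; apply: leq_trans Mn; apply: ltnW; exact: ltM.
  by rewrite /address -[X in s _ _ X = _]ft (split_pt (cell_splitting t n)).
have fN n : (N <= n)%N -> first_index (cell t n) = first_index (cell t N).
  move=> /subnK <-; elim: (n - N)%N => // m IH; rewrite addSn.
  set k := (m + N)%N in IH *.
  have [cf minf] := cellf t k; have [cf1 minf1] := cellf t k.+1.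
  rewrite -IH; apply/eqP; rewrite eqn_leq; apply/andP; split.
    apply: minf1; split=> //=; rewrite (split_pt (cell_splitting t k)).
    by rewrite -[RHS]/(address t k) tN // leq_addl.
  by apply: minf; case: cf1.
exists (first_index (cell t N)) => //; apply: address_digit_base.1.
apply/funext => n.
have [cf _] := cellf t (maxn N n.+1).
rewrite fN ?leq_maxl // in cf.
have /agree_cell := cf; apply; exact: leq_maxr.
Qed.

End Scheme.

(** Under repeated splitting, [T] becomes the full sequence space on [I], with
    any prescribed countable dense set [D] mapped to the eventually [i0]
    sequences.  Since the image of [D] does not depend on [D], this gives both
    the uniqueness of [T] up to homeomorphism and its countable dense
    homogeneity, without a back-and-forth argument. *)
Theorem address_system (T : topologicalType) (A : Type) (d : T -> nat -> A)
    (I : Type) (i0 : I) (D : set T) :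
  digit_base d -> prefix_closed (range d) ->
  [set: T] !=set0 -> countable D -> dense D ->
  (forall n C p, open C -> C p -> exists s, splitting d i0 n C p s) ->
  exists a : T -> nat -> I, [/\ digit_base a, forall x, exists t, a t = x &
    D = [set t | exists N, forall n, (N <= n)%N -> a t n = i0]].
Proof.
move=> dT dC [t0 _] cD dD spl.
have [e De] : exists e : nat -> T, D = range e.
  have [p [_ Dp]] := dD setT (ex_intro _ t0 Logic.I) openT.
  have /countable_injP[f finj] := cD.
  exists (fun n => xget p (D `&` [set t | f t = n])).
  apply/seteqP; split=> [t Dt|_ [n _ <-]].
    exists (f t) => //=; case: xgetP => [u -> [Du /= ut]|/(_ t)].
      by apply: finj; rewrite ?inE.
    by move=> /(_ (conj Dt erefl)).
  by case: xgetP => [u -> [] |_] //.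
have /choice[s sP] : forall nC : nat * set T, exists s, clopen nC.2 ->
    nC.2 !=set0 -> splitting d i0 nC.1 nC.2 (e (first_index e nC.2)) s.
  move=> [n C] /=; have [[[oC cC] C0]|nC] := EM (clopen C /\ C !=set0).
    rewrite De in dD; have [Cf _] := first_indexP dD oC C0.
    by have [s ss] := spl n C _ oC Cf; exists s.
  by exists (fun _ => i0) => clC C0; case: nC.
pose s' n C := s (n, C).
have sP' : forall n C, clopen C -> C !=set0 ->
    splitting d i0 n C (e (first_index e C)) (s' n C).
  by move=> n C; exact: sP (n, C).
rewrite De in dD.
exists (address s'); split.
- exact: (address_digit_base dT sP').
- exact: (address_surjective dT dC sP').
- by rewrite De; exact: (range_address dT dD sP').
Qed.

Lemma homeomorphic_digits (S T : topologicalType) I (a : S -> nat -> I)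
    (b : T -> nat -> I) : digit_base a -> digit_base b ->
  (forall x, exists t, a t = x) -> (forall x, exists t, b t = x) ->
  exists2 h : S -> T, homeomorphism h & forall t, b (h t) = a t.
Proof.
move=> aS bT asurj bsurj.
have /choice[h bh] : forall t, exists u, b u = a t by move=> t; exact: bsurj.
have /choice[g ag] : forall t, exists u, a u = b t by move=> t; exact: asurj.
exists h => //; split.
  by apply/(digit_continuous h aS bT) => t n; exists n => u; rewrite !bh.
exists g; split=> [|t|t].
- by apply/(digit_continuous g bT aS) => t n; exists n => u; rewrite !ag.
- by apply: aS.1; rewrite ag bh.
- by apply: bT.1; rewrite bh ag.
Qed.

(** When all digits are booleans, an open set is split according to its [n]-th
    digit, or, if that digit is constant on it, according to any other digit
    that separates two of its points. *)
Lemma bool_splitting (T : topologicalType) (d : T -> nat -> bool) n C p :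
  digit_base d -> (forall t n, exists2 u, agree n (d u) (d t) & u <> t) ->
  open C -> C p -> exists s, splitting d false n C p s.
Proof.
move=> dT perf oC Cp.
have [m [q Cq pq] mn] : exists2 m, (exists2 q, C q & d q m <> d p m) &
    (forall t u, C t -> C u -> d t m = d u m -> d t n = d u n).
  have [[q Cq pq]|nq] := EM (exists2 q, C q & d q n <> d p n).
    by exists n => //; exists q.
  have dn t : C t -> d t n = d p n.
    by move=> Ct; apply: contrapT => tp; apply: nq; exists t.
  have [k kC] := (digit_open dT C).1 oC p Cp.
  have [q qp nqp] := perf p k.
  have [m qm] : exists m, d q m <> d p m.
    by apply/existsNP => qm; apply: nqp; apply: dT.1; exact/funext.
  exists m; first by exists q => //; exact: kC.
  by move=> t u Ct Cu _; rewrite !dn.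
exists (fun t => d t m (+) d p m); split=> [t||b|t u Ct Cu].
- apply: filterS (nbhs_agree dT t m.+1) => u /= -> //.
- exact: addbb.
- case: b; last by exists p => //; exact: addbb.
  by exists q => //; move: pq; case: (d q m); case: (d p m).
- by move=> /addIb/(mn _ _ Ct Cu).
Qed.

(** An infinite set of codes is renumbered onto [nat], sending a chosen code to
    [0] by composing with a transposition. *)
Lemma infinite_renumbering (S : set nat) k : infinite_set S -> S k ->
  exists phi : nat -> nat, [/\ phi k = 0%N, set_inj S phi &
    forall j, exists2 i, S i & phi i = j].
Proof.
move=> infS Sk.
have /pcard_eqP/bijPex[f [fS finj fsurj]] : S #= [set: nat] by exact: eq_card_nat.
pose swap j := if j == 0%N then f k else if j == f k then 0%N else j.
have swapK : involutive swap.
  move=> j; rewrite /swap; have [->|j0] := eqVneq j 0%N.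
    by have [->|fk0] := eqVneq (f k) 0%N; rewrite ?eqxx //.
  by have [->|jk] := eqVneq j (f k); rewrite ?eqxx // (negbTE j0) (negbTE jk).
exists (swap \o f); split=> [|i j Si Sj /(inv_inj swapK)|j].
- by rewrite /= /swap; have [->//|fk0] := eqVneq (f k) 0%N; rewrite eqxx.
- exact: finj.
- have [i Si fi] := fsurj (swap j) Logic.I; exists i => //=.
  by rewrite fi swapK.
Qed.

(** The failure of local compactness enters as a locally constant function
    with infinite range on [C]; together with the [n]-th digit it partitions
    [C] into infinitely many pieces. *)
Lemma nat_splitting (T : topologicalType) (A : countType) (d : T -> nat -> A)
    n C p :
  digit_base d ->
  (exists2 f : T -> nat, (forall t, nbhs t [set u | f u = f t]) &
     infinite_set (f @` C)) ->
  C p -> exists s, splitting d 0%N n C p s.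
Proof.
move=> dT [f fcont finf] Cp.
pose g t : nat := pickle (d t n, f t).
have gE t u : g t = g u -> d t n = d u n /\ f t = f u.
  by move=> /(pcan_inj pickleK)[].
have ginf : infinite_set (g @` C).
  move=> fing; apply: finf.
  pose h (k : nat) := if @unpickle (A * nat)%type k is Some x then x.2 else 0%N.
  suff -> : f @` C = h @` (g @` C) by exact: finite_image.
  rewrite image_comp; apply: eq_imagel => t _ /=.
  by rewrite /h /g pickleK.
have [phi [phi0 phi_inj phi_onto]] := infinite_renumbering ginf (imageP g Cp).
exists (phi \o g); split=> [t||i|t u Ct Cu /=].
- apply: filterS (filterI (nbhs_agree dT t n.+1) (fcont t)) => u /= [ut fu].
  by rewrite /g fu ut.
- exact: phi0.
- have [_ [t Ct <-] phii] := phi_onto i.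
  by exists t.
- move=> /phi_inj gtu; have [|] := gE t u _ => //.
  by apply: gtu; rewrite inE; exact: imageP.
Qed.

Lemma partial_choice (S B : Type) (R : S -> B -> Prop) (b0 : B) :
  exists c : S -> B, forall s, (exists b, R s b) -> R s (c s).
Proof.
have /choice[c cR] : forall s, exists b, (exists b, R s b) -> R s b.
  move=> s; have [[b Rb]|nR] := EM (exists b, R s b); first by exists b.
  by exists b0.
by exists c.
Qed.

Lemma digit_separable (T : topologicalType) (A : countType) (d : T -> nat -> A) :
  digit_base d -> [set: T] !=set0 -> separable_space T.
Proof.
move=> dT [t0 _].
have [c cP] := partial_choice (fun s t => exists n, mkseq (d t) n = s) t0.
exists (range c).
  by apply: countable_image; exact: countableP.
apply/(digit_dense dT) => t n; exists (c (mkseq (d t) n)).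
  by exists (mkseq (d t) n).
have [|m cm] := cP (mkseq (d t) n); first by exists t, n.
have mn : m = n by rewrite -(size_mkseq (d (c (mkseq (d t) n))) m) cm size_mkseq.
by apply/agree_mkseq; move: cm; rewrite mn.
Qed.

Lemma splitting_cdh (T : topologicalType) (A : countType) (d : T -> nat -> A)
    (I : Type) (i0 : I) :
  digit_base d -> prefix_closed (range d) ->
  [set: T] !=set0 ->
  (forall n C p, open C -> C p -> exists s, splitting d i0 n C p s) ->
  countable_dense_homogeneous T.
Proof.
move=> dT dC T0 spl; split; first exact: digit_separable dT T0.
move=> D D' cD dD cD' dD'.
have [a [aT asurj ->]] := address_system dT dC T0 cD dD spl.
have [b [bT bsurj ->]] := address_system dT dC T0 cD' dD' spl.
have [h hh ba] := homeomorphic_digits aT bT asurj bsurj.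
exists h => //; apply/seteqP; split=> [_ [t [N tN] <-]|u [N uN]].
  by exists N => n Nn; rewrite ba tN.
have [_ [g [_ gh hg]]] := hh; exists (g u); last exact: hg.
by exists N => n Nn; rewrite -ba hg uN.
Qed.

Lemma splitting_homeomorphic (T S : topologicalType) (A : countType)
    (d : T -> nat -> A) (I : Type) (i0 : I) (b : S -> nat -> I) :
  digit_base d -> prefix_closed (range d) -> [set: T] !=set0 ->
  (forall n C p, open C -> C p -> exists s, splitting d i0 n C p s) ->
  digit_base b -> (forall x, exists t, b t = x) ->
  homeomorphic T S.
Proof.
move=> dT dC T0 spl bS bsurj.
have [D cD dD] := digit_separable dT T0.
have [a [aT asurj _]] := address_system dT dC T0 cD dD spl.
by have [h hh _] := homeomorphic_digits aT bS asurj bsurj; exists h.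
Qed.

Lemma prefix_closedT A : prefix_closed (range (id : (nat -> A) -> (nat -> A))).
Proof. by move=> x _; exists x. Qed.

Lemma bool_seq_perfect n (x : nat -> bool) :
  exists2 y : nat -> bool, agree n y x & y <> x.
Proof.
exists (fun k => if k == n then ~~ x n else x k).
  by move=> k kn; rewrite (ltn_eqF kn).
by move=> /(congr1 (@^~ n)); rewrite eqxx; case: (x n).
Qed.

Theorem cantor_cdh : countable_dense_homogeneous cantor_space.
Proof.
apply: (splitting_cdh cantor_digit_base) => [||n C p oC Cp].
- exact: prefix_closedT.
- by exists (fun=> false).
- apply: bool_splitting Cp => //; first exact: cantor_digit_base.
  by move=> t m; exact: bool_seq_perfect.
Qed.

Theorem baire_cdh : countable_dense_homogeneous baire_space.
Proof.
apply: (splitting_cdh baire_digit_base) => [||n C p oC Cp].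
- exact: prefix_closedT.
- by exists (fun=> 0%N).
- apply: nat_splitting (Cp); first exact: baire_digit_base.
  have [m mC] := (digit_open baire_digit_base C).1 oC p Cp.
  exists (fun t => t m).
    by move=> t; apply: filterS (nbhs_agree baire_digit_base t m.+1) => u; apply.
  suff -> : (fun t : baire_space => t m) @` C = setT by exact: infinite_nat.
  apply/seteqP; split=> // k _.
  exists (fun j => if j == m then k else p j); last by rewrite eqxx.
  by apply: mC => j jm; rewrite (ltn_eqF jm).
Qed.

Lemma homeomorphism_dense (S T : topologicalType) (f : S -> T) (D : set S) :
  homeomorphism f -> dense D -> dense (f @` D).
Proof.
move=> [+ [g [cg fg gf]]] dD U [u Uu] oU => /continuousP cf.
have [||t [Ut Dt]] := dD (f @^-1` U).
- by exists (g u); rewrite /= gf.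
- exact: cf.
- by exists (f t); split=> //; exists t.
Qed.

Lemma homeomorphism_inv (S T : topologicalType) (f : S -> T) :
  homeomorphism f -> exists2 g, homeomorphism g & cancel f g /\ cancel g f.
Proof.
move=> [cf [g [cg fg gf]]]; exists g => //.
by split=> //; exists f.
Qed.

Lemma homeomorphism_comp (S T U : topologicalType) (f : S -> T) (g : T -> U) :
  homeomorphism f -> homeomorphism g -> homeomorphism (g \o f).
Proof.
move=> [cf [f' [cf' ff' f'f]]] [cg [g' [cg' gg' g'g]]]; split.
  by move=> x; apply: continuous_comp; [exact: cf|exact: cg].
exists (f' \o g'); split; [|exact: can_comp..].
by move=> x; apply: continuous_comp; [exact: cg'|exact: cf'].
Qed.

Lemma homeomorphic_cdh (S T : topologicalType) : homeomorphic S T ->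
  countable_dense_homogeneous T -> countable_dense_homogeneous S.
Proof.
move=> [f hf] [[E cE dE] cdhT].
have [g hg [fg gf]] := homeomorphism_inv hf.
split; first by exists (g @` E); [exact: countable_image|exact: homeomorphism_dense].
move=> D D' cD dD cD' dD'.
have [|||| h hh hD] := cdhT (f @` D) (f @` D').
- exact: countable_image.
- exact: homeomorphism_dense.
- exact: countable_image.
- exact: homeomorphism_dense.
exists (g \o (h \o f)).
  by apply: homeomorphism_comp => //; exact: homeomorphism_comp.
apply/seteqP; split=> [_ [t Dt <-]|t D't] /=.
  have : (h @` (f @` D)) (h (f t)) by exists (f t) => //; exists t.
  by rewrite hD => -[u D'u <-]; rewrite fg.
have : (f @` D') (f t) by exists t.
by rewrite -hD => -[_ [u Du <-] hfu]; exists u; rewrite //= hfu fg.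
Qed.

(** * Powers of G-delta subsets of the Cantor space *)

Definition update (Z : Type) (t : nat -> Z) (m : nat) (z : Z) : nat -> Z :=
  fun i => if i == m then z else t i.

Lemma update_same Z (t : nat -> Z) m z : update t m z m = z.
Proof. by rewrite /update eqxx. Qed.

(** Finitely many digits of a sequence only involve finitely many of its
    coordinates, so a remote coordinate is free. *)
Lemma update_fresh (Z A : Type) (d : Z -> nat -> A) n : exists m, forall t z,
  agree n (power_digits d (update t m z)) (power_digits d t).
Proof.
have [m mP] := ubound_fun (fun k => (unpair k).1) n.
exists m => t z k kn; rewrite /power_digits /update.
by rewrite (ltn_eqF (mP k kn)).
Qed.

Section GdeltaDigits.
Context (X : set cantor_space) (O_ : nat -> set cantor_space).
Hypothesis O_open : forall n, open (O_ n).
Hypothesis XE : X = \bigcap_n O_ n.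

(** The prefix of [x] of length [k] certifies that [x] belongs to [O_ n].  The
    length of the shortest certificate for each [n] is recorded as an additional
    digit of [x] in [gdelta_digits]: sequences of digits that are limits of such
    records belong to every [O_ n], so the records form a closed set. *)
Definition decided n (x : nat -> bool) k :=
  forall y : cantor_space, agree k (y : nat -> bool) x -> O_ n y.

Lemma decidedP : exists e : X -> nat -> nat, forall x n,
  decided n (val x) (e x n) /\ forall k, decided n (val x) k -> (e x n <= k)%N.
Proof.
suff /choice[e eP] : forall xn : X * nat, exists k, decided xn.2 (val xn.1) k /\
    forall j, decided xn.2 (val xn.1) j -> (k <= j)%N.
  by exists (fun x n => e (x, n)) => x n; exact: eP (x, n).
move=> [x n] /=.
have Onx : O_ n (val x) by have := set_valP x; rewrite {1}XE; apply.
have [k0 k0P] := (digit_open cantor_digit_base (O_ n)).1 (O_open n) _ Onx.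
have ex : exists k, `[< decided n (val x) k >] by exists k0; exact/asboolP.
case: (ex_minnP ex) => k /asboolP kP kmin; exists k; split=> // j jP.
exact/kmin/asboolP.
Qed.

Variable e : X -> nat -> nat.
Hypothesis eP : forall x n,
  decided n (val x) (e x n) /\ forall k, decided n (val x) k -> (e x n <= k)%N.

Definition gdelta_digits (x : X) (n : nat) : bool * nat := (val_digits x n, e x n).

Lemma decided_agree n x y k : agree k y x -> decided n x k -> decided n y k.
Proof. by move=> yx xk z zy; apply: xk; exact: agree_trans yx. Qed.

Lemma gdelta_digits_agree x y n k : agree k (val_digits y) (val_digits x) ->
  (e x n <= k)%N -> e y n = e x n.
Proof.
move=> yx xk; have [dx xmin] := eP x n; have [dy ymin] := eP y n.
have yx' : agree (e x n) (val_digits y) (val_digits x) by exact: agree_le yx.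
have ey : (e y n <= e x n)%N.
  by apply: ymin; exact: decided_agree dx.
apply/eqP; rewrite eqn_leq ey /=; apply: xmin; apply: decided_agree dy.
by apply/agree_sym; exact: agree_le yx'.
Qed.

Lemma gdelta_digit_base : digit_base gdelta_digits.
Proof.
have dX := val_digit_base X.
split=> [x y xy|x U].
  apply: dX.1; apply/funext => n.
  by have := congr1 (fun f => (f n).1) xy.
have gd y n : agree n (gdelta_digits y) (gdelta_digits x) ->
    agree n (val_digits y) (val_digits x).
  by move=> yx k /yx[].
split=> [/dX.2[n nU]|[n nU]]; first by exists n => y /gd/nU.
apply/dX.2; have [m mP] := ubound_fun (e x) n; exists (maxn m n) => y yx.
apply: nU => k kn; rewrite /gdelta_digits (gdelta_digits_agree yx).
  by rewrite yx // leq_max kn orbT.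
by apply: ltnW; rewrite leq_max mP.
Qed.

Lemma gdelta_prefix_closed : prefix_closed (range gdelta_digits).
Proof.
move=> z zlim; pose x : cantor_space := fun n => (z n).1.
have lim n : exists2 y, agree n (val_digits y) x &
    forall k, (k < n)%N -> e y k = (z k).2.
  have [_ [y _ <-] yz] := zlim n; exists y => k kn; by rewrite /x -yz.
have dec n : decided n x (z n).2.
  have [y yx yz] := lim (maxn n.+1 (z n).2).
  rewrite -yz ?leq_maxl //; apply: decided_agree (eP y n).1.
  rewrite yz ?leq_maxl //; apply/agree_sym/agree_le/yx; exact: leq_maxr.
have Xx : X x by rewrite XE => n _; apply: dec.
have Xx' : x \in X by rewrite inE.
pose x' : X := SigSub Xx'.
exists x' => //; apply/funext => n; rewrite /gdelta_digits.
have [y yx yz] := lim (maxn n.+1 (e x' n)).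
rewrite -(@gdelta_digits_agree x' y n _ yx) ?leq_maxr // yz ?leq_maxl //.
by rewrite [RHS]surjective_pairing.
Qed.

(** If all certificates for [O_ n] had length at most [b n], then [X] would be
    the intersection of the clopen sets of points certified by their prefix of
    length [b n].  This unboundedness is the source of infinite partitions. *)
Lemma gdelta_unbounded : ~ closed X -> exists n, forall b, exists x, (b < e x n)%N.
Proof.
move=> nclX; apply: contrapT => /forallNP bdd; apply: nclX.
have /choice[b bP] : forall n, exists b, forall x, (e x n <= b)%N.
  move=> n; have /existsNP[b /forallNP bP] := bdd n.
  by exists b => x; rewrite leqNgt; apply/negP; exact: bP.
apply/(digit_closed cantor_digit_base) => t tX; rewrite XE => n _.
have [u Xu ut] := tX (b n); have Xu' : u \in X by rewrite inE.
apply: (eP (SigSub Xu') n).1 => /=.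
apply/agree_sym; apply: agree_le ut; exact: bP.
Qed.

End GdeltaDigits.

Lemma unbounded_infinite (S : set nat) : (forall b, exists2 k, S k & (b < k)%N) ->
  infinite_set S.
Proof.
move=> unb /finite_seqP[F SF].
have [k Sk] := unb (\max_(i <- F) i).
rewrite ltnNge => /negP; apply; rewrite SF /= in Sk.
exact: leq_bigmax_seq.
Qed.

Lemma closed_power_cantor (X : set cantor_space) (a b : X) : closed X -> a <> b ->
  homeomorphic (omega_power X) cantor_space.
Proof.
move=> clX ab; have dX := val_digit_base X.
have cX : prefix_closed (range (@val_digits X)).
  move=> x xlim; have Xx : X x.
    apply: ((digit_closed cantor_digit_base X).1 clX) => n.
    have [_ [y _ <-] yx] := xlim n; exists (val y) => //.
    exact: set_valP.
  have Xx' : (x : cantor_space) \in X by rewrite inE.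
  by exists (SigSub Xx').
apply: (@splitting_homeomorphic (omega_power X) _ _ _ _ false _
  (power_digit_base dX)).
- exact: power_prefix_closed.
- by exists (fun=> a).
- move=> n C p oC Cp; apply: bool_splitting oC Cp; first exact: power_digit_base.
  move=> t m; have [j jP] := update_fresh (@val_digits X) m.
  exists (update t j (if t j == a then b else a)); first exact: jP.
  move=> /(congr1 (@^~ j)); rewrite update_same.
  have [ta|/eqP ta] := eqVneq (t j) a; last by move=> /esym.
  by rewrite ta => /esym.
- exact: cantor_digit_base.
- by move=> x; exists x.
Qed.

Lemma gdelta_power_baire (X : set cantor_space) (a : X) : Gdelta X -> ~ closed X ->
  homeomorphic (omega_power X) baire_space.
Proof.
move=> [U_ U_open XE] nclX.
have [e eP] := decidedP U_open XE.
have dX := gdelta_digit_base eP.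
have cX := gdelta_prefix_closed XE eP.
have [n0 n0P] := gdelta_unbounded XE eP nclX.
apply: (@splitting_homeomorphic (omega_power X) _ _ _ _ 0%N _
  (power_digit_base dX)).
- exact: power_prefix_closed.
- by exists (fun=> a).
- move=> n C p oC Cp; have dP := power_digit_base dX.
  apply: nat_splitting (Cp); first exact: dP.
  have [m mC] := (digit_open dP C).1 oC p Cp.
  have [j jP] := update_fresh (gdelta_digits e) m.
  exists (fun t => e (t j) n0).
    move=> t; apply: filterS (nbhs_agree dP t (pair_code j n0).+1) => u.
    by move=> /(_ _ (ltnSn _)); rewrite !power_digitsE => -[].
  apply: unbounded_infinite => b; have [x bx] := n0P b.
  exists (e x n0) => //; exists (update p j x); last by rewrite update_same.
  by apply: mC; exact: jP.
- exact: baire_digit_base.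
- by move=> x; exists x.
Qed.

(** A compact [X] gives a one-point power or a Cantor space, a noncompact one
    gives the Baire space. *)
Lemma Gdelta_trichotomy (X : set cantor_space) : X !=set0 -> Gdelta X ->
  [\/ [set: omega_power X] #= `I_1,
      homeomorphic (omega_power X) cantor_space
    | homeomorphic (omega_power X) baire_space].
Proof.
move=> [x0 Xx0] GX; have Xx0' : x0 \in X by rewrite inE.
pose a : X := SigSub Xx0'.
have [clX|nclX] := EM (closed X); last by apply: Or33; exact: gdelta_power_baire.
have [[b ab]|one] := EM (exists b : X, a <> b).
  by apply: Or32; exact: closed_power_cantor clX ab.
apply: Or31; suff -> : [set: omega_power X] = [set (fun=> a)] by exact: card_set1.
apply/seteqP; split=> // t _; apply/funext => i.
by apply: contrapT => ta; apply: one; exists (t i) => at_; apply: ta.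
Qed.

Lemma one_point_cdh (T : topologicalType) : [set: T] #= `I_1 ->
  countable_dense_homogeneous T.
Proof.
move=> /card_set_bijP[f [f0 finj fsurj]].
have [t _ _] := fsurj 0%N (ltn0Sn 0).
have one u : u = t.
  have ft v : f v = 0%N by have := f0 v Logic.I; rewrite /= ltnS leqn0 => /eqP.
  by apply: finj; rewrite ?inE // !ft.
have full (D : set T) : dense D -> D = setT.
  move=> dD; apply/seteqP; split=> // u _; rewrite (one u).
  have [|v [_ Dv]] := dD setT _ openT; first by exists t.
  by rewrite -(one v).
split.
  exists [set t]; first exact: countable1.
  by move=> U [u Uu] _; exists u; split=> //=; exact: one.
move=> D D' _ /full -> _ /full ->; exists id; last exact: image_id.
by split; [|exists id; split=> //]; move=> x; exact: cvg_id.
Qed.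

Lemma trichotomy_cdh (X : set cantor_space) :
  [\/ [set: omega_power X] #= `I_1,
      homeomorphic (omega_power X) cantor_space
    | homeomorphic (omega_power X) baire_space] ->
  countable_dense_homogeneous (omega_power X).
Proof.
case; first exact: one_point_cdh.
- by move=> h; exact: homeomorphic_cdh h cantor_cdh.
- by move=> h; exact: homeomorphic_cdh h baire_cdh.
Qed.

(** * Baire category and analytic sets *)

(** The Baire category theorem in a closed subset [F] of a sequence space. *)
Lemma prefix_closed_baire A (F : set (nat -> A)) (U : nat -> set (nat -> A)) :
  prefix_closed F ->
  (forall k x n, F x -> exists y m, [/\ F y, agree n y x &
     forall z, F z -> agree m z y -> U k z]) ->
  forall x n, F x -> exists y, [/\ F y, agree n y x & forall k, U k y].
Proof.
move=> clF dU x n Fx.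
have /choice[step stepP] : forall kp : nat * ((nat -> A) * nat),
    exists q : (nat -> A) * nat,
    F kp.2.1 -> [/\ F q.1, agree kp.2.2 q.1 kp.2.1, (kp.2.2 < q.2)%N &
      forall z, F z -> agree q.2 z q.1 -> U kp.1 z].
  move=> [k [y m]] /=; have [Fy|nFy] := EM (F y); last by exists (y, m).
  have [z [l [Fz zy zU]]] := dU k y m Fy.
  exists (z, maxn l m.+1) => _; split=> //=; first exact: leq_maxr.
  by move=> w Fw wz; apply: zU => //; apply: agree_le wz; exact: leq_maxl.
pose q := fix q k := if k is j.+1 then step (j, q j) else (x, n).
have Fq k : F (q k).1.
  by elim: k => //= k IH; have [] := stepP (k, q k) IH.
have qS k : [/\ agree (q k).2 (q k.+1).1 (q k).1, ((q k).2 < (q k.+1).2)%N &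
    forall z, F z -> agree (q k.+1).2 z (q k.+1).1 -> U k z].
  by have [] := stepP (k, q k) (Fq k).
have q2 k : (k <= (q k).2)%N.
  by elim: k => // k IH; have [_ lt _] := qS k; exact: leq_ltn_trans lt.
have qle k l : (k <= l)%N ->
    ((q k).2 <= (q l).2)%N /\ agree (q k).2 (q l).1 (q k).1.
  move=> /subnK <-; elim: (l - k)%N => // j [IH1 IH2]; rewrite addSn.
  have [ag lt _] := qS (j + k)%N; split; first exact/(leq_trans IH1)/ltnW.
  by apply: agree_trans IH2; exact: agree_le ag.
pose y j := (q j.+1).1 j.
have yq k : agree (q k).2 y (q k).1.
  move=> j jk; have [kj|/ltnW jk'] := leqP k j.+1.
    by have [_ ] := qle _ _ kj; apply.
  by have [_ ->] := qle _ _ jk' => //; exact: q2.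
have Fy : F y.
  apply: clF => k; exists (q k).1 => //.
  by apply/agree_sym; apply: agree_le (yq k).
exists y; split=> //; first exact: (yq 0%N).
by move=> k; have [_ _] := qS k; apply.
Qed.

Definition first_digits (z : nat -> bool * nat) : cantor_space := fun n => (z n).1.

(** Analytic sets as projections of closed subsets of the product of the Cantor
    and Baire spaces, whose elements are written as sequences of pairs. *)
Definition analytic (S : set cantor_space) : Prop :=
  exists2 F : set (nat -> bool * nat), prefix_closed F & S = first_digits @` F.

Lemma closed_analytic C : closed C -> analytic C.
Proof.
move=> /(digit_closed cantor_digit_base) clC.
exists [set z | C (first_digits z)].
  move=> z zlim; apply: clC => n; have [y Cy yz] := zlim n.
  by exists (first_digits y) => // k kn; rewrite /first_digits yz.
apply/seteqP; split=> [x Cx|_ [z Cz <-]//].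
by exists (fun n => (x n, 0%N)).
Qed.

(** The natural digit at position [0] is the length of a prefix that puts the
    point inside [V]. *)
Lemma open_analytic (V : set cantor_space) : open V -> analytic V.
Proof.
move=> /(digit_open cantor_digit_base) oV.
exists [set z | forall x : cantor_space,
    agree (z 0%N).2 (x : nat -> bool) (first_digits z) -> V x].
  move=> z zlim x xz; have [y Vy yz] := zlim (maxn 1 (z 0%N).2).
  apply: Vy; rewrite yz ?leq_maxl //.
  by move=> k kz; rewrite xz // /first_digits yz // leq_max kz orbT.
apply/seteqP; split=> [x Vx|_ [z Vz <-]]; last exact: Vz.
have [n nV] := oV _ Vx.
by exists (fun k => (x k, n)).
Qed.

(** The natural digit at position [0] says which set the point belongs to, and
    the later ones are its witness. *)
Lemma analytic_bigcup (S : nat -> set cantor_space) :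
  (forall n, analytic (S n)) -> analytic (\bigcup_n S n).
Proof.
move=> aS; have /choice[F FS] : forall n, exists F, prefix_closed F /\
    S n = first_digits @` F by move=> n; have [F clF SF] := aS n; exists F.
have clF n : prefix_closed (F n) by have [] := FS n.
have SF n : S n = first_digits @` F n by have [] := FS n.
pose shift (z : nat -> bool * nat) k := ((z k).1, (z k.+1).2).
exists [set z | F (z 0%N).2 (shift z)].
  move=> z zlim; apply: clF => n; have [y Fy yz] := zlim n.+1.
  exists (shift y); first by rewrite -yz.
  by move=> k kn; rewrite /shift !yz // ltnW.
apply/seteqP; split=> [x [n _]|_ [z Fz <-]].
  rewrite SF => -[z Fz zx].
  exists (fun k => ((z k).1, if k is j.+1 then (z j).2 else n)) => //=.
  rewrite (_ : shift _ = z) //; apply/funext => k.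
  by rewrite /shift /= -surjective_pairing.
by exists (z 0%N).2 => //; rewrite SF; exists (shift z).
Qed.

(** The natural digits hold witnesses for all the sets at once, interleaved. *)
Lemma analytic_bigcap (S : nat -> set cantor_space) :
  (forall n, analytic (S n)) -> analytic (\bigcap_n S n).
Proof.
move=> aS; have /choice[F FS] : forall n, exists F, prefix_closed F /\
    S n = first_digits @` F by move=> n; have [F clF SF] := aS n; exists F.
have clF n : prefix_closed (F n) by have [] := FS n.
have SF n : S n = first_digits @` F n by have [] := FS n.
pose slice (z : nat -> bool * nat) n k := ((z k).1, (z (pair_code n k)).2).
exists [set z | forall n, F n (slice z n)].
  move=> z zlim n; apply: clF => m.
  have [b bP] := ubound_fun (pair_code n) m.
  have [y Fy yz] := zlim (maxn b m); exists (slice y n) => // k km.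
  by rewrite /slice !yz // leq_max ?km ?orbT // bP.
apply/seteqP; split=> [x Sx|_ [z Fz <-] n _].
  have /choice[z zP] : forall n, exists z, F n z /\ first_digits z = x.
    by move=> n; have := Sx n Logic.I; rewrite SF => -[z Fz zx]; exists z.
  exists (fun k => (x k, (z (unpair k).1 (unpair k).2).2)) => // n.
  rewrite (_ : slice _ n = z n); first by have [] := zP n.
  apply/funext => k; rewrite /slice /= pair_codeK /=.
  by have [_ <-] := zP n; rewrite /first_digits -surjective_pairing.
by rewrite SF; exists (slice z n).
Qed.

Lemma borel_ind (T : topologicalType) (P : set (set T)) :
  (forall V, open V -> P V) -> (forall S, P S -> P (~` S)) ->
  (forall S : nat -> set T, (forall n, P (S n)) -> P (\bigcup_n S n)) ->
  forall X, borel_set X -> P X.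
Proof.
move=> Po PC PU X bX; apply: bX; split=> //; split.
- by apply: Po; exact: open0.
- by move=> S PS; rewrite setTD; exact: PC.
- exact: PU.
Qed.

Lemma borel_complement_analytic X : borel_set X -> analytic (~` X).
Proof.
move=> bX; suff [] : analytic X /\ analytic (~` X) by [].
apply: (@borel_ind _ (fun S => analytic S /\ analytic (~` S))) bX =>
  [V oV|S [aS aCS]|S aS].
- split; first exact: open_analytic.
  by apply: closed_analytic; exact: open_closedC.
- by rewrite setCK.
- split; first by apply: analytic_bigcup => n; have [] := aS n.
  by rewrite setC_bigcup; apply: analytic_bigcap => n; have [] := aS n.
Qed.

(** * Sets all of whose countable subsets are enclosed in small G-delta sets *)

Section Hurewicz.
Context (X : set cantor_space) (F : set (nat -> bool * nat)).
Hypothesis clF : prefix_closed F.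
Hypothesis XF : ~` X = first_digits @` F.

(** [S] is covered by an F-sigma set that misses [X]. *)
Definition separated (S : set cantor_space) : Prop :=
  exists C : nat -> set cantor_space,
    [/\ forall n, closed (C n), S `<=` \bigcup_n C n & \bigcup_n C n `<=` ~` X].

Lemma separated_bigcup (K : countType) (S : K -> set cantor_space) :
  (forall i, separated (S i)) -> separated (\bigcup_i S i).
Proof.
move=> /choice[C CP].
exists (fun n => if @unpickle K (unpair n).1 is Some i
  then C i (unpair n).2 else set0).
split=> [n|x [i _ Six]|x [n _]].
- by case: unpickle => [i|]; [have [] := CP i|exact: closed0].
- have [_ SC _] := CP i; have [k _ Cx] := SC _ Six.
  by exists (pair_code (pickle i) k) => //; rewrite pair_codeK /= pickleK.
- case: unpickle => // i Cx; have [_ _ CX] := CP i; apply: CX.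
  by exists (unpair n).2.
Qed.

Lemma separated_sub S1 S2 : S1 `<=` S2 -> separated S2 -> separated S1.
Proof.
by move=> S12 [C [clC SC CX]]; exists C; split=> //; exact: subset_trans SC.
Qed.

Lemma separatedU S1 S2 : separated S1 -> separated S2 -> separated (S1 `|` S2).
Proof.
move=> s1 s2; apply: (@separated_sub _ (\bigcup_(b : bool) if b then S1 else S2)).
  by move=> x [S1x|S2x]; [exists true|exists false].
by apply: separated_bigcup => -[].
Qed.

Definition cylinder_in (s : seq (bool * nat)) : set cantor_space :=
  first_digits @` (F `&` [set z | mkseq z (size s) = s]).

(** The part of [F] left after removing every basic piece whose projection is
    separated from [X].  Only countably many pieces are removed, so the
    projection of what is removed is separated as a whole. *)
Definition kernel_part : set (nat -> bool * nat) :=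
  F `&` [set z | forall n, ~ separated (cylinder_in (mkseq z n))].

Lemma kernel_part_closed : prefix_closed kernel_part.
Proof.
move=> z zlim; split.
  by apply: clF => n; have [y [Fy _] yz] := zlim n; exists y.
move=> n /=; have [y [_ /(_ n)]] := zlim n.
by move=> + /agree_mkseq <-.
Qed.

Lemma separated_off_kernel : separated (first_digits @` (F `\` kernel_part)).
Proof.
apply: (@separated_sub _ (\bigcup_(s : seq (bool * nat))
    (cylinder_in s `&` [set x | separated (cylinder_in s)]))).
  move=> _ [z [Fz nkz] <-].
  have [n /contrapT sepn] : exists n, ~ ~ separated (cylinder_in (mkseq z n)).
    by apply/existsNP => nsep; apply: nkz.
  exists (mkseq z n) => //; split=> //; exists z => //; split=> //=.
  by rewrite size_mkseq.
apply: separated_bigcup => s; have [seps|nseps] := EM (separated (cylinder_in s)).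
  by apply: separated_sub seps => x [].
by exists (fun=> set0); split=> [n|x []//|x []//]; exact: closed0.
Qed.

(** Otherwise that closure, together with the removed part, would separate the
    projection of the piece, which would then have been removed. *)
Lemma kernel_closure z n : kernel_part z -> exists2 x, X x &
  closure (first_digits @` (kernel_part `&` [set y | agree n y z])) x.
Proof.
move=> [Fz zk]; apply: contrapT => nx; apply: (zk n).
set C := closure _ in nx.
apply: (@separated_sub _ (C `|` first_digits @` (F `\` kernel_part))).
  move=> _ [y [Fy /= yz] <-].
  have [ky|nky] := EM (kernel_part y); [left|by right; exists y].
  apply: subset_closure; exists y => //; split=> //.
  by apply/agree_mkseq; rewrite size_mkseq in yz.
apply: separatedU separated_off_kernel.
exists (fun=> C); split=> [_|x Cx|x [_ _ Cx] Xx].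
- exact: closed_closure.
- by exists 0%N.
- by apply: nx; exists x.
Qed.

(** A form of Hurewicz's theorem.  If the kernel is empty then the complement of
    [X] is an F-sigma set.  Otherwise pick a point of [X] adherent to the
    projection of each basic piece of the kernel; if these countably many points
    lie in a G-delta set, then the preimage of that set in the kernel is a dense
    G-delta set, so by Baire's theorem it is nonempty and the G-delta set
    contains a point outside [X]. *)
Lemma countably_enclosed_Gdelta :
  (forall B : set cantor_space, countable B -> B `<=` X ->
     exists V : nat -> set cantor_space,
       [/\ forall k, open (V k), B `<=` \bigcap_k V k & \bigcap_k V k `<=` X]) ->
  Gdelta X.
Proof.
move=> encl.
have [[z0 kz0]|k0] := EM (exists z, kernel_part z); last first.
  have [C [clC FC CX]] := separated_off_kernel.
  exists (fun n => ~` C n); first by move=> n; exact: closed_openC.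
  rewrite -setC_bigcup; apply: setC_inj; rewrite setCK.
  apply/seteqP; split=> // x Xx.
  apply: FC; move: Xx; rewrite XF => -[z Fz zx]; exists z => //; split=> // kz.
  by apply: k0; exists z.
exfalso.
pose R s x := exists z n, [/\ kernel_part z, mkseq z n = s, X x &
  closure (first_digits @` (kernel_part `&` [set y | agree n y z])) x].
have [c cR] := @partial_choice _ _ R (fun=> false).
pose B := c @` [set s | exists x, R s x].
have [|x [s /cR] []|V [oV BV VX]] := encl B.
- by apply: countable_image; exact: countableP.
- by move=> z [n [_ _ ? _]] <-.
have [||y [ky _ yV]] := @prefix_closed_baire _ kernel_part
  (fun k => [set z | V k (first_digits z)]) _ _ z0 0%N kz0.
- exact: kernel_part_closed.
- move=> k z n kz.
  have [x Xx xcl] := kernel_closure n kz.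
  have [|z' [n' []]] := cR (mkseq z n); first by exists x, z, n.
  move=> kz' z'z Xb bcl; set b := c _ in Xb bcl.
  have Vb : V k b by apply: BV => //; exists (mkseq z n) => //; exists x, z, n.
  have [_ [[y [ky yz'] <-] Vy]] := bcl _ (open_nbhs_nbhs (conj (oV k) Vb)).
  have [m mV] := (digit_open cantor_digit_base (V k)).1 (oV k) _ Vy.
  exists y, m; split=> //.
    have nn' : n' = n by rewrite -(size_mkseq z' n') z'z size_mkseq.
    by move: yz' z'z; rewrite nn' => yz' /agree_mkseq; exact: agree_trans.
  by move=> w _ wy; apply: mV => j jm; rewrite /first_digits wy.
have /VX : (\bigcap_k V k) (first_digits y) by move=> k _; exact: yV.
have : (~` X) (first_digits y) by rewrite XF; exists y => //; case: ky.
by [].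
Qed.

End Hurewicz.

(** * Category in a countable dense homogeneous power *)

Lemma open_dense_ord (T : topologicalType) (M : nat -> set T) n :
  (forall j, open (M j) /\ dense (M j)) ->
  open [set t | forall j, (j < n)%N -> M j t] /\
  dense [set t | forall j, (j < n)%N -> M j t].
Proof.
move=> odM; elim: n => [|n [oI dI]].
  rewrite (_ : mkset _ = setT); last exact/seteqP.
  by split; [exact: openT|move=> V V0 _; rewrite setIT].
rewrite (_ : mkset _ = M n `&` [set t | forall j, (j < n)%N -> M j t]).
  have [oM dM] := odM n.
  by split; [exact: openI|exact: denseI].
apply/seteqP; split=> [t Mt|t [Mn Mt] j] /=.
  by split=> [|j jn]; apply: Mt => //; exact: ltnW.
by rewrite ltnS leq_eqVlt => /orP[/eqP ->//|/Mt].
Qed.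

Section PowerSpace.
Context (X : set cantor_space).
Let Xo : topologicalType := omega_power X.

Definition bool_digits : Xo -> nat -> bool := power_digits (@val_digits X).

Lemma bool_digit_base : digit_base bool_digits.
Proof. exact: power_digit_base (val_digit_base X). Qed.

Lemma proj_val_open i (V : set cantor_space) : open V ->
  open [set t : Xo | V (val (t i))].
Proof.
move=> oV; apply/(digit_open bool_digit_base) => t Vt.
have [n nV] := (digit_open cantor_digit_base V).1 oV _ Vt.
have [m mP] := power_digits_agree (@val_digits X) i n.
by exists m => u ut; apply: nV; exact: mP.
Qed.

(** A dense set with one point for each finite binary word, chosen subject to a
    constraint [P] that can be met near every point. *)
Lemma enumerated_dense_set (P : seq bool -> set Xo) (t0 : Xo) :
  (forall s t n, mkseq (bool_digits t) n = s ->
     exists2 u, P s u & agree n (bool_digits u) (bool_digits t)) ->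
  exists c : seq bool -> Xo,
    dense (c @` [set s | P s (c s)]).
Proof.
move=> dP.
have [c cP] := partial_choice
  (fun s t => P s t /\ exists n, mkseq (bool_digits t) n = s) t0.
exists c; apply/(digit_dense bool_digit_base) => t n.
set s := mkseq (bool_digits t) n.
have [|Pcs [m cm]] := cP s.
  have [u Pu ut] := dP s t n erefl; exists u; split=> //; exists n.
  exact/agree_mkseq.
exists (c s); first by exists s.
have mn : m = n by rewrite -(size_mkseq (bool_digits (c s)) m) cm size_mkseq.
by apply/agree_mkseq; rewrite mn in cm.
Qed.

Lemma countable_cimage (c : seq bool -> Xo) (S : set (seq bool)) :
  countable (c @` S).
Proof. by apply: countable_image; exact: countableP. Qed.

(** Suppose that the [M j] had empty intersection.  Choose a countable dense
    set [D] with only finitely many points outside each [M j], and another one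
    that contains a countable dense subset of a copy [g] of the Cantor space.
    A homeomorphism between them transports the [M j] to open sets that
    have no common point on this copy, so by Baire's theorem one of them misses
    a cylinder of it.  That cylinder contains infinitely many points of the second dense set,
    a contradiction. *)
Lemma cdh_nonmeager (a b : X) (M : nat -> set Xo) : a <> b ->
  countable_dense_homogeneous Xo ->
  (forall j, open (M j) /\ dense (M j)) -> \bigcap_j M j !=set0.
Proof.
move=> ab [_ cdh] odM; apply: contrapT => M0.
have dX := bool_digit_base.
pose P (s : seq bool) : set Xo :=
  [set t | forall j, (j < (pickle s).+1)%N -> M j t].
have [|c dD] := @enumerated_dense_set P (fun=> a).
  move=> s t n _.
  have [_ /(digit_dense dX) dP] := open_dense_ord (pickle s).+1 odM.
  exact: dP.
set D := c @` _ in dD.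
have D_M j t : D t -> ~ M j t -> exists2 s, c s = t & (pickle s < j)%N.
  move=> [s /= Ps <-] nM; exists s => //; rewrite ltnNge; apply/negP => js.
  exact/nM/Ps.
pose g (y : cantor_space) : Xo := fun i => if y i then b else a.
have g_cont : continuous g.
  apply/(digit_continuous g cantor_digit_base dX) => y n.
  have [m mP] := ubound_fun (fun k => (unpair k).1) n.
  exists m => z zy k kn; rewrite /bool_digits /power_digits /g.
  by rewrite (zy _ (mP k kn)).
have g_inj : injective g.
  move=> y z yz; apply/funext => i; have := congr1 (@^~ i) yz; rewrite /g.
  by case: (y i); case: (z i) => // /esym.
(* q (s, i) extends s by i zeros, a single one, and then zeros; for fixed s
   these are infinitely many points of one cylinder *)
pose q (si : seq bool * nat) : cantor_space := fun m =>
  if (m < size si.1)%N then nth false si.1 m else m == (size si.1 + si.2)%N.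
pose D' := D `|` g @` range q.
have cD : countable D by exact: countable_cimage.
have [||h hh hD] := cdh D D' cD dD.
- apply: countable_setU => //; rewrite image_comp.
  by apply: countable_image; exact: countableP.
- move=> V V0 oV; have [t [Vt Dt]] := dD V V0 oV.
  by exists t; split=> //; left.
have [hi hhi [hK hiK]] := homeomorphism_inv hh.
pose k := hi \o g.
have k_cont : continuous k.
  by move=> y; apply: continuous_comp; [exact: g_cont|exact: hhi.1].
have k_inj : injective k by apply: inj_comp => //; exact: can_inj hiK.
have kD si : D (k (q si)).
  have : D' (g (q si)) by right; exists (q si) => //; exists si.
  by rewrite -hD => -[t Dt hg]; rewrite /k /= -hg hK.
have [j [x [n jxn]]] : exists j x n, forall y : cantor_space,
    agree n (y : nat -> bool) x -> ~ M j (k y).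
  apply: contrapT => nex.
  have [|j x n _|y [_ _ yM]] := @prefix_closed_baire bool setT
    (fun j => [set y | M j (k y)]) _ _ (fun=> false) 0%N Logic.I.
  - by [].
  - have [y [yx My]] : exists y : cantor_space,
        agree n (y : nat -> bool) x /\ M j (k y).
      apply: contrapT => nM; apply: nex; exists j, x, n => y yx My.
      by apply: nM; exists y.
    have ok : open (k @^-1` M j).
      by move/continuousP: k_cont; apply; exact: (odM j).1.
    have [m mM] := (digit_open cantor_digit_base _).1 ok y My.
    by exists y, m; split=> // z _; exact: mM.
  - by apply: M0; exists (k y) => j _; exact: yM.
have /choice[s sP] : forall i, exists s,
    c s = k (q (mkseq x n, i)) /\ (pickle s < j)%N.
  move=> i; have [||s cs sj] := D_M j (k (q (mkseq x n, i))).
  - exact: kD.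
  - apply: jxn => m mn; rewrite /q /= size_mkseq mn nth_mkseq //.
  - by exists s.
have s_inj : injective s.
  move=> i i' ii'; have := (sP i).1; rewrite ii' (sP i').1 => /k_inj.
  move/(congr1 (fun y => y (n + i)%N)); rewrite /q /= size_mkseq.
  by rewrite ltnNge leq_addr /= eqxx eqn_add2l => /eqP.
(* pigeonhole: points of D outside M j are among j of its points *)
pose f (i : 'I_j.+1) : 'I_j := Ordinal (sP i).2.
suff /leq_card : injective f by rewrite !card_ord ltnn.
move=> i i' /(congr1 val) /= /(pcan_inj pickleK) /s_inj; exact: val_inj.
Qed.

End PowerSpace.

(** * The category dichotomy for powers of Borel sets *)

(** The Baire property of [S] relative to the subspace [K], formulated with
    subsets of the ambient space; the sets [N k] are closed and nowhere dense
    in [K]. *)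
Definition baire_property (K S : set cantor_space) : Prop :=
  exists (U : set cantor_space) (N : nat -> set cantor_space),
  [/\ open U,
      forall k, closed (N k),
      forall k V, open V -> V `&` K !=set0 -> (V `&` K) `\` N k !=set0 &
      forall x, K x -> (forall k, ~ N k x) -> (S x <-> U x)].

Lemma open_baire_property K U : open U -> baire_property K U.
Proof.
move=> oU; exists U, (fun=> set0); split=> // [k|k V oV [x VKx]].
  exact: closed0.
by exists x; split.
Qed.

(** Replacing an open set by the exterior of its trace on [K] costs one more
    nowhere dense set, the boundary. *)
Lemma baire_propertyC K S : baire_property K S -> baire_property K (~` S).
Proof.
move=> [U [N [oU clN ndN SU]]].
pose C := closure (U `&` K).
exists (~` C), (fun k => if k is j.+1 then N j else C `\` U); split.
- by apply: closed_openC; exact: closed_closure.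
- by case=> [|k //]; apply: closedI; [exact: closed_closure|exact: open_closedC].
- case=> [|k V oV VK]; last exact: ndN.
  move=> V oV [x [Vx Kx]].
  have [[y [Vy [Uy Ky]]]|nVU] := EM ((V `&` (U `&` K)) !=set0).
    by exists y; split=> // -[].
  exists x; split=> // -[Cx _]; apply: nVU.
  have [y [UKy Vy]] := Cx V (open_nbhs_nbhs (conj oV Vx)).
  by exists y.
- move=> x Kx nN; have SUx := SU x Kx (fun k => nN k.+1).
  split=> [nSx Cx|nCx Sx].
    by apply: (nN 0%N); split=> // /SUx.
  by apply: nCx; apply: subset_closure; split=> //; exact/SUx.
Qed.

Lemma baire_property_bigcup K (S : nat -> set cantor_space) :
  (forall n, baire_property K (S n)) -> baire_property K (\bigcup_n S n).
Proof.
move=> /choice[U /choice[N UNP]].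
exists (\bigcup_n U n), (fun p => N (unpair p).1 (unpair p).2); split.
- by apply: bigcup_open => n _; have [] := UNP n.
- by move=> p; have [] := UNP (unpair p).1.
- by move=> p; have [_ _ ndN _] := UNP (unpair p).1; exact: ndN.
- move=> x Kx nN.
  have SU n : S n x <-> U n x.
    have [_ _ _] := UNP n; apply=> // k; have := nN (pair_code n k).
    by rewrite pair_codeK.
  by split=> -[n _ /SU]; exists n.
Qed.

Lemma borel_baire_property K X : borel_set X -> baire_property K X.
Proof.
apply: (@borel_ind _ (baire_property K)).
- exact: open_baire_property.
- exact: baire_propertyC.
- exact: baire_property_bigcup.
Qed.

(** Let [X] agree in its closure with the open set [U] up to meager sets.  If
    [U] is not dense there, then [X] is meager in some open [V0]; a sequence in
    [X] either never visits [V0], which is a nowhere dense event, or has a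
    coordinate in a meager set, so the power is meager.  Hence [U] is dense and
    [X] is comeager in its closure. *)
Lemma nonmeager_power_comeager (X : set cantor_space) : borel_set X ->
  (forall M : nat -> set (omega_power X),
     (forall j, open (M j) /\ dense (M j)) -> \bigcap_j M j !=set0) ->
  exists W : nat -> set cantor_space,
    [/\ forall k, open (W k),
        forall k V, open V -> V `&` closure X !=set0 ->
          V `&` closure X `&` W k !=set0 &
        closure X `&` \bigcap_k W k `<=` X].
Proof.
move=> bX nonmeager.
have [U [N [oU clN ndN XU]]] := borel_baire_property (closure X) bX.
have [[V0 [oV0 V0K V0U]]|Udense] := EM (exists V, [/\ open V,
    V `&` closure X !=set0 & V `&` closure X `&` U = set0]).
  exfalso.
  have meetX V : open V -> V `&` closure X !=set0 -> exists x : X, V (val x).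
    move=> oV [x [Vx clx]]; have [y [Xy Vy]] := clx V (open_nbhs_nbhs (conj oV Vx)).
    have Xy' : y \in X by rewrite inE.
    by exists (SigSub Xy').
  (* M 0 consists of the sequences that visit V0, and each of the other sets
     keeps one coordinate out of one N k *)
  pose M p : set (omega_power X) := if p is p'.+1
    then [set t | (~` N (unpair p').2) (val (t (unpair p').1))]
    else \bigcup_i [set t | V0 (val (t i))].
  have [|t Mt] := nonmeager M.
    case=> [|p]; split.
    - by apply: bigcup_open => i _; exact: proj_val_open.
    - apply/(digit_dense (bool_digit_base X)) => t n.
      have [x V0x] := meetX V0 oV0 V0K.
      have [m mP] := update_fresh (@val_digits X) n.
      exists (update t m x); last exact: mP.
      by exists m => //=; rewrite update_same.
    - by apply: proj_val_open; exact: closed_openC.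
    - apply/(digit_dense (bool_digit_base X)) => t n.
      have [m mP] := agree_power_digits (@val_digits X) n.
      set i := (unpair p).1; set k := (unpair p).2.
      pose V := [set y : cantor_space | agree m (y : nat -> bool) (val (t i))].
      have oV : open V := digit_open_ball cantor_digit_base (val (t i)) m.
      have [||x [Vx nNx]] := meetX (V `\` N k).
      + by apply: openI => //; exact: closed_openC.
      + have [|y [[Vy Ky] nNy]] := ndN k V oV.
          exists (val (t i)); split=> //; apply: subset_closure; exact: set_valP.
        by exists y.
      + exists (update t i x); first by rewrite /= update_same.
        apply: mP => l lm; rewrite /update; case: eqP => // ->; exact: Vx.
  have [i _ V0t] := Mt 0%N Logic.I.
  have Kt : closure X (val (t i)) by apply: subset_closure; exact: set_valP.
  have Ut : U (val (t i)).
    apply/(XU _ Kt); last exact: set_valP.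
    by move=> k Nk; have := Mt (pair_code i k).+1 Logic.I; rewrite /M pair_codeK.
  suff : set0 (val (t i)) by [].
  by rewrite -V0U.
exists (fun k => if k is j.+1 then ~` N j else U); split.
- by case=> // k; exact: closed_openC.
- case=> [V oV VK|k V oV VK]; last exact: ndN.
  apply: contrapT => /set0P/negP/negPn/eqP VKU; apply: Udense.
  by exists V.
- move=> x [Kx Wx]; apply/(XU x Kx).
    by move=> k; exact: (Wx k.+1 Logic.I).
  exact: (Wx 0%N Logic.I).
Qed.

(** * Enclosing countable sets by means of homeomorphisms *)

Section Enclosure.
Context (X : set cantor_space) (W : nat -> set cantor_space).
Hypothesis W_open : forall k, open (W k).
Hypothesis W_dense : forall k V, open V -> V `&` closure X !=set0 ->
  V `&` closure X `&` W k !=set0.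
Hypothesis WX : closure X `&` \bigcap_k W k `<=` X.
Let K := closure X.
(** A dense G-delta subset of the closure of [X], contained in [X]; its power
    is a completely metrizable dense part of the power of [X]. *)
Let H := K `&` \bigcap_k W k.

Lemma comeager_part_dense x n : X x ->
  exists2 y, H y & agree n (y : nat -> bool) (x : nat -> bool).
Proof.
move=> Xx; have [|||y [Ky yx Wy]] := @prefix_closed_baire bool K W _ _ x n.
- move=> y ylim; apply/(digit_closure cantor_digit_base) => m.
  have [z Kz zy] := ylim m.
  have [u Xu uz] := (digit_closure cantor_digit_base X z).1 Kz m.
  by exists u => //; exact: agree_trans zy.
- move=> k y m Ky.
  have [|z [[/= zy Kz] Wz]] := @W_dense k _ (digit_open_ball cantor_digit_base y m).
    by exists y.
  have [l lW] := (digit_open cantor_digit_base (W k)).1 (W_open k) z Wz.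
  by exists z, l; split=> // u _; exact: lW.
- exact: subset_closure.
- by exists y => //; split=> // k _; exact: Wy.
Qed.

Let Xo : topologicalType := omega_power X.
Let dT := @bool_digits X.

Lemma comeager_power_countable_dense (a : X) : exists D : set Xo,
  [/\ countable D, dense D & forall t, D t -> forall i, H (val (t i))].
Proof.
pose P (s : seq bool) : set Xo := [set t | forall i, H (val (t i))].
have [|c dD] := @enumerated_dense_set X P (fun=> a).
  move=> s t n _; have [m mP] := agree_power_digits (@val_digits X) n.
  have /choice[u uP] : forall i, exists x : X, H (val x) /\
      agree m (val_digits x) (val_digits (t i)).
    move=> i; have [y Hy yt] := comeager_part_dense m (set_valP (t i)).
    have Xy : y \in X by rewrite inE; exact: WX.
    by exists (SigSub Xy).
  exists u; first by move=> i; have [] := uP i.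
  by apply: mP => i _; have [] := uP i.
exists (c @` [set s | P s (c s)]); split=> //; first exact: countable_cimage.
by move=> _ [s Ps <-].
Qed.

Variables h g : Xo -> Xo.
Hypothesis h_cont : continuous h.
Hypothesis g_cont : continuous g.
Hypothesis gK : cancel g h.

Let f (x : X) : Xo := g (fun=> x).
(** The [i]-th coordinate of a sequence in the power, read off its digits; it
    makes sense for arbitrary sequences of digits, which need not come from the
    power. *)
Definition slice i (z : nat -> bool) : cantor_space := fun j => z (pair_code i j).

Lemma slice_digits (t : Xo) i : slice i (dT t) = val (t i).
Proof. by apply/funext => j; rewrite /slice /dT /bool_digits power_digitsE. Qed.

Lemma slice_agree i n : exists m, forall y z, agree m y z ->
  agree n (slice i y : nat -> bool) (slice i z).
Proof.
have [m mP] := ubound_fun (pair_code i) n.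
by exists m => y z yz k kn; apply: yz; exact: mP.
Qed.

(** Membership in all these open sets says that [x] is a limit of points [x'] of
    [X] along which [f x'] converges to a point of the power of [H].  This is
    Lavrentiev's device: a G-delta set of the ambient Cantor space has to be
    produced from a map that is only defined on [X]. *)
Definition enclosing p : set cantor_space := [set x |
  (exists x' : X, agree p (val_digits x') x) /\
  exists m l y, [/\ (p <= l)%N,
    forall z, agree l z y -> W (unpair p).2 (slice (unpair p).1 z) &
    forall x' : X, agree m (val_digits x') x -> agree l (dT (f x')) y]].

Lemma enclosing_open p : open (enclosing p).
Proof.
apply/(digit_open cantor_digit_base) => x [[x' x'x] [m [l [y [pl yW fy]]]]].
exists (maxn p m) => u ux; split.
  exists x'; apply: agree_trans x'x _; apply: agree_sym; apply: agree_le ux.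
  exact: leq_maxl.
exists m, l, y; split=> // v vu; apply: fy; apply: agree_trans vu _.
by apply: agree_le ux; exact: leq_maxr.
Qed.

Lemma constant_sequence_image_continuous x n : exists m, forall x' : X,
  agree m (val_digits x') (val_digits x) ->
  agree n (dT (f x')) (dT (f x)).
Proof.
have dX := bool_digit_base X.
have [m mP] := (digit_continuous g dX dX).1 g_cont (fun=> x) n.
have [l lP] := agree_power_digits (@val_digits X) m.
by exists l => x' x'x; apply: mP; apply: lP.
Qed.

(** By continuity of [f] at [x] and openness of the [W k]. *)
Lemma enclosing_good p (x : X) :
  (forall i, H (val (f x i))) -> enclosing p (val x).
Proof.
move=> Hfx; split; first by exists x.
set i := (unpair p).1; set k := (unpair p).2.
have [_ /(_ k Logic.I) Wf] := Hfx i.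
have [n nW] := (digit_open cantor_digit_base (W k)).1 (W_open k) _ Wf.
have [l lP] := slice_agree i n.
have [m mP] := constant_sequence_image_continuous x (maxn p l).
exists m, (maxn p l), (dT (f x)); split=> //; first exact: leq_maxl.
move=> z zf; apply: nW; rewrite -slice_digits; apply: lP.
by apply: agree_le zf; exact: leq_maxr.
Qed.

(** The limit [t] of [f x'] lies in the power of [H], hence in that of [X],
    where [h] is defined and continuous.  As [h (f x')] is the constant sequence
    [x'], the sequence [h t] is the constant sequence [x]; but its terms are
    points of [X]. *)
Lemma bigcap_enclosing_sub : \bigcap_p enclosing p `<=` X.
Proof.
move=> x nx.
have near n : exists x' : X, agree n (val_digits x') x by have [] := nx n Logic.I.
have /choice[m /choice[l /choice[y yP]]] : forall p, exists m l y, [/\ (p <= l)%N,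
    forall z, agree l z y -> W (unpair p).2 (slice (unpair p).1 z) &
    forall x' : X, agree m (val_digits x') x -> agree l (dT (f x')) y].
  by move=> p; have [] := nx p Logic.I.
(* y p is only reliable below l p, and p <= l p *)
pose z n := y n.+1 n.
have fz n : exists q, forall x' : X,
    agree q (val_digits x') x -> agree n (dT (f x')) z.
  have [q qP] := ubound_fun (fun k => m k.+1) n.
  exists q => x' x'x k kn; have [ll _ fy] := yP k.+1.
  by apply: fy => //; apply: agree_le x'x; exact/ltnW/qP.
have zy p : agree (l p) z (y p).
  have [q qP] := fz (l p); have [_ _ fy] := yP p.
  have [x' x'x] := near (maxn q (m p)) => k kl.
  rewrite -(qP x') //; last by apply: agree_le x'x; exact: leq_maxl.
  by apply: fy => //; apply: agree_le x'x; exact: leq_maxr.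
have Hz i : H (slice i z).
  split.
    apply/(digit_closure cantor_digit_base) => n.
    have [n' n'P] := slice_agree i n; have [q qP] := fz n'.
    have [x' x'x] := near q; exists (val (f x' i)); first exact: set_valP.
    by rewrite -slice_digits; apply: n'P; exact: qP.
  move=> k _; have [_ + _] := yP (pair_code i k); rewrite pair_codeK; apply.
  exact: zy.
have Xz i : slice i z \in X by rewrite inE; exact/WX/Hz.
pose t : Xo := fun i => SigSub (Xz i).
(* z is consistent also at indices that are not codes of pairs, as a limit of
   sequences of digits of points *)
have dt : dT t = z.
  apply/funext => n; set i := (unpair n).1; set j := (unpair n).2.
  have [q qP] := fz (maxn n (pair_code i j)).+1; have [x' x'x] := near q.
  have {}qP := qP x' x'x.
  rewrite -[RHS]qP ?ltnS ?leq_maxl // -[LHS]/(z (pair_code i j)).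
  rewrite -qP ?ltnS ?leq_maxr // /dT /bool_digits.
  by rewrite power_digitsE.
suff -> : x = val (h t 0%N) by exact: set_valP.
apply/funext => j; have dX := bool_digit_base X.
have [n nP] := (digit_continuous h dX dX).1 h_cont t (pair_code 0 j).+1.
have [q qP] := fz n; have [x' x'x] := near (maxn q j.+1).
have {}nP : agree (pair_code 0 j).+1 (dT (h (f x'))) (dT (h t)).
  by apply: nP; rewrite -/dT dt; apply: qP; apply: agree_le x'x; exact: leq_maxl.
have := nP (pair_code 0 j) (ltnSn _).
rewrite /f gK /dT /bool_digits !power_digitsE => ht.
rewrite -[RHS]/(val_digits (h t 0%N) j) -ht.
by rewrite x'x // leq_max ltnSn orbT.
Qed.

End Enclosure.

(** * The equivalence *)

(** Any countable [B] contained in [X] is enclosed in a G-delta set contained in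
    [X]: a homeomorphism [h] carries a countable dense subset of the power of the
    comeager part onto its union with the constant sequences with value in
    [B]. *)
Lemma cdh_power_Gdelta (X : set cantor_space) : X !=set0 -> borel_set X ->
  countable_dense_homogeneous (omega_power X) -> Gdelta X.
Proof.
move=> [x0 Xx0] bX cdh.
have Xx0' : x0 \in X by rewrite inE.
pose a : X := SigSub Xx0'.
have [[b ab]|one] := EM (exists b : X, a <> b); last first.
  have -> : X = [set x0].
    apply/seteqP; split=> [x Xx|_ ->//]; apply: contrapT => xx0; apply: one.
    have Xx' : x \in X by rewrite inE.
    by exists (SigSub Xx') => /(congr1 val) /= /esym.
  exists (fun n => [set x : cantor_space | agree n (x : nat -> bool) x0]).
    by move=> n; exact: digit_open_ball cantor_digit_base x0 n.
  apply/seteqP; split=> [_ -> n _//|x xx0 /=]; apply/funext => n.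
  exact: (xx0 n.+1 Logic.I).
have [|W [W_open W_dense WX]] := nonmeager_power_comeager bX.
  by move=> M; exact: cdh_nonmeager ab cdh.
have [F clF XF] := borel_complement_analytic bX.
apply: (countably_enclosed_Gdelta clF XF) => B cB BX.
have [D [cD dD DH]] := comeager_power_countable_dense W_open W_dense WX a.
have [_ cdh'] := cdh.
pose diag := [set t : omega_power X | exists2 x : X, B (val x) & t = fun=> x].
have [||h hh hD] := cdh' D (D `|` diag) cD dD.
- apply: countable_setU => //.
  have -> : diag = (fun (x : X) => (fun=> x) : omega_power X) @`
      [set x : X | B (val x)].
    by apply/seteqP; split=> [t [x Bx ->]|t [x Bx <-]]; exists x.
  apply: countable_image.
  have /countable_injP[e einj] := cB; apply/countable_injP.
  exists (e \o val) => x y; rewrite !inE /= => Bx By exy.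
  by apply: val_inj; apply: einj; rewrite ?inE.
- move=> V V0 oV; have [t [Vt Dt]] := dD V V0 oV.
  by exists t; split=> //; left.
have [g [g_cont _] [hK gK]] := homeomorphism_inv hh.
exists (enclosing W g); split.
- exact: enclosing_open.
- move=> x Bx p _; have Xx : x \in X by rewrite inE; exact: BX.
  apply: (enclosing_good W_open g_cont p (x := SigSub Xx)).
  apply: DH.
  have : (D `|` diag) (fun=> SigSub Xx) by right; exists (SigSub Xx).
  by rewrite -hD => -[t Dt ht]; rewrite -ht hK.
- exact: (bigcap_enclosing_sub WX hh.1 gK).
Qed.

Theorem theorem3p2 (X : set cantor_space) (X_neq0 : X !=set0)
    (X_borel : borel_set X) :
  [<-> countable_dense_homogeneous (omega_power X);
       Gdelta X;
       [\/ [set: omega_power X] #= `I_1,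
           homeomorphic (omega_power X) cantor_space
         | homeomorphic (omega_power X) baire_space]].
Proof.
tfae.
- exact: cdh_power_Gdelta.
- exact: Gdelta_trichotomy.
- exact: trichotomy_cdh.
Qed.
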